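(* (In ZFC.) There exists an almost disjoint family $A$ of infinite subsets of a countably infinite set such that the space $\Psi(A)$ is semi-proximal and not normal.
   Context: For an almost disjoint family $A$ of infinite subsets of a countably infinite set $D$ (distinct members have finite intersection), the $\Psi$-space $\Psi(A)$ has underlying set $D\cup A$ (disjoint union); points of $D$ are isolated, and a local base at the point $a\in A$ consists of the sets $\{a\}\cup (a\setminus F)$ with $F\subseteq D$ finite. The proximal game on a uniform space $(X,\mathfrak U)$ (where $\mathfrak U$ is a uniformity or a base for a uniformity): in inning $0$, Player I chooses an entourage $U_0\in\mathfrak U$ and Player II chooses $x_0\in X$. In inning $n+1$, Player I chooses an entourage $U_{n+1}\in\mathfrak U$ with $U_{n+1}\subseteq U_n$ and Player II chooses $x_{n+1}\in U_n[x_n]=\{y\in X:\langle x_n,y\rangle\in U_n\}$. Player I wins if either $\bigcap_{n<\omega}U_n[x_n]=\emptyset$ or the sequence $(x_n:n<\omega)$ converges in $X$; otherwise Player II wins. A space $X$ is semi-proximal if there is a uniformity $\mathfrak U$ on $X$ compatible with its topology such that Player II has no winning strategy in the proximal game on $(X,\mathfrak U)$. *)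

(* Defs.v *)
From HB Require Import structures.
From mathcomp Require Import all_boot all_classical.
From mathcomp Require Import topology.

Set Implicit Arguments.
Unset Strict Implicit.
Unset Printing Implicit Defensive.

Local Open Scope classical_set_scope.

Definition almost_disjoint (D : Type) (A : set (set D)) : Prop :=
  forall a b, A a -> A b -> a <> b -> finite_set (a `&` b).

Definition Psi (D : Type) (A : set (set D)) : Type := (D + A)%type.

Section PsiTopology.
Context (D : Type) (A : set (set D)).

Definition Psi_base (a : A) (F : set D) : set (Psi A) :=
  inr a |` inl @` (\val a `\` F).

Definition Psi_nbhs (x : Psi A) : set_system (Psi A) :=
  match x with
  | inl d => principal_filter (inl d)
  | inr a => filter_from finite_set (Psi_base a)
  end.

Let Psi_nbhs_filter (x : Psi A) : ProperFilter (Psi_nbhs x).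
Proof.
case: x => [d|a]; first exact: principal_filter_proper.
apply: filter_from_proper; last by move=> F _; exists (inr a); left.
apply: filter_from_filter; first by exists set0; exact: finite_set0.
move=> F G finF finG; exists (F `|` G); first by rewrite finite_setU.
move=> y [->|[d [ad nFG] <-]]; first by split; left.
by split; right; exists d => //; split=> // ?; apply: nFG; [left|right].
Qed.

Let Psi_nbhs_singleton (x : Psi A) (N : set (Psi A)) : Psi_nbhs x N -> N x.
Proof.
case: x => [d|a]; first by move/principal_filterP.
by case=> F _; apply; left.
Qed.

Let Psi_nbhs_nbhs (x : Psi A) (N : set (Psi A)) :
  Psi_nbhs x N -> Psi_nbhs x (Psi_nbhs^~ N).
Proof.
case: x => [d|a]; first by move=> Nd; exact/principal_filterP.
case=> F finF FN; exists F => // y [->|[d Fd <-]]; first by exists F.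
by apply/principal_filterP; apply: FN; right; exists d.
Qed.

HB.instance Definition _ := gen_eqMixin (Psi A).
HB.instance Definition _ := gen_choiceMixin (Psi A).
HB.instance Definition _ := hasNbhs.Build (Psi A) Psi_nbhs.
HB.instance Definition _ := Nbhs_isNbhsTopological.Build (Psi A)
  Psi_nbhs_filter Psi_nbhs_singleton Psi_nbhs_nbhs.

End PsiTopology.

Section ProximalGame.
Context (X : topologicalType).
Implicit Types (E : set_system (X * X)) (U : nat -> set (X * X)) (x : nat -> X).

Definition playerI_legal E U : Prop :=
  (forall n, E (U n)) /\ (forall n, U n.+1 `<=` U n).

Definition playerII_legal U x : Prop :=
  forall n, xsection (U n) (x n) (x n.+1).

Definition playerI_wins U x : Prop :=
  \bigcap_n xsection (U n) (x n) = set0 \/ exists l : X, x @ \oo --> l.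

(* A strategy for Player II maps the position [:: U_0; ...; U_n] to x_n; Player
   II's earlier moves are determined by the strategy, so they are not passed. *)
Definition playerII_moves (sigma : seq (set (X * X)) -> X) U : nat -> X :=
  fun n => sigma (mkseq U n.+1).

Definition playerII_winning_strategy E (sigma : seq (set (X * X)) -> X) : Prop :=
  forall U, playerI_legal E U ->
    playerII_legal U (playerII_moves sigma U) /\
    ~ playerI_wins U (playerII_moves sigma U).

End ProximalGame.

(* The equality says that the carrier and the topology of U are those of X. *)
Definition semi_proximal (X : topologicalType) : Prop :=
  exists U : uniformType, U = X :> topologicalType /\
    ~ exists sigma, playerII_winning_strategy (@entourage U) sigma.

(* Main.v *)
(** Identify [D] with the binary tree and take for [A] the set of branches of
[X], where the points of the Cantor space are coloured with three colours so
that every perfect set meets all of them, and [X] consists of two colours.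

The uniformity is that of the compact metrizable space (tree + Cantor space),
refined by letting finitely many branches be split off.  A run lost by Player I
converges in this compact space to a point [L] of [X] whose branch was never
split off; [L] depends continuously on the moves of Player I.  From any position
Player I can make the limit change by splitting off the branch of the limit of
some continuation.  So a winning strategy of Player II yields a Cantor scheme of
runs whose limits form a perfect subset of [X], which does not exist.

For non-normality, separate one colour [Y] of [X] from the other one by a set [B]
of nodes.  As the other colour meets every cone, nodes outside [B] are dense, so
some perfect set consists of points with infinitely many nodes outside [B]; but
it meets [Y]. *)

Require Import Defs.
From HB Require Import structures.
From mathcomp Require Import all_boot all_classical.
From mathcomp Require Import wochoice topology normedtype.

Set Implicit Arguments.
Unset Strict Implicit.
Unset Printing Implicit Defensive.

Local Open Scope classical_set_scope.

(** * Well-orders and transfinite choice of distinct points *)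

Lemma exists_wf_total (I : Type) : exists lt : I -> I -> Prop,
  well_founded lt /\ forall i j, i <> j -> lt i j \/ lt j i.
Proof.
have [R Rwo] := well_ordering_principle {classic I}.
have ex_min (A : set I) : A !=set0 -> exists2 z, A z & forall x, A x -> R z x.
  move=> [x Ax].
  have /Rwo[z [[/asboolP Az zmin] _]] :
      nonempty (fun x : {classic I} => `[< A x >]).
    by exists x; apply/asboolP.
  by exists z => // y Ay; apply: zmin; apply/asboolP.
have Rtot i j : R i j || R j i.
  have [|z [->|->] zmin] := ex_min [set i; j]; first by exists i; left.
    by rewrite zmin //; right.
  by rewrite (zmin i) ?orbT //; left.
have Ranti i j : R i j -> R j i -> i = j.
  move=> Rij Rji; have [] := Rwo (fun x => `[< x = i \/ x = j >]).
    by exists i; apply/asboolP; left.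
  have Rr k : R k k by have := Rtot k k; rewrite orbb.
  move=> z [_ zuniq]; rewrite -(zuniq i) ?(zuniq j) //; split;
    try by apply/asboolP; auto.
    by move=> x /asboolP[] ->.
  by move=> x /asboolP[] ->.
exists (fun i j => R i j /\ i <> j); split.
- move=> i; apply: contrapT => nAi.
  have [|z nAz zmin] := ex_min [set x | ~ Acc (fun i j => R i j /\ i <> j) x].
    by exists i.
  apply: nAz; constructor => y [Ryz neq]; apply: contrapT => nAy.
  by apply: neq; apply: Ranti => //; apply: zmin.
- move=> i j neq; have /orP[Rij|Rji] := Rtot i j; first by left.
  by right; split=> //; exact: nesym.
Qed.

(* If some proper initial segment of [I] admits an injection from [T], compose
   the embedding of [I] into the least such segment with the order. *)
Lemma exists_small_segments (T I : Type) (g : I -> T) : injective g ->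
  exists lt : I -> I -> Prop, [/\ well_founded lt,
    forall i j, i <> j -> lt i j \/ lt j i &
    forall i, ~ exists f : T -> I, injective f /\ forall t, lt (f t) i].
Proof.
move=> g_inj; have [lt [wf tot]] := exists_wf_total I.
pose big i := exists f : T -> I, injective f /\ forall t, lt (f t) i.
have [[i0 bigi0]|nobig] := pselect (exists i, big i); last first.
  by exists lt; split=> // i bigi; apply: nobig; exists i.
have [i [[f [f_inj fi]] imin]] : exists i, big i /\ forall j, lt j i -> ~ big j.
  elim/(well_founded_ind wf): i0 bigi0 => i IH bigi.
  have [[j [ltji bigj]]|nj] := pselect (exists j, lt j i /\ big j).
    exact: (IH j).
  by exists i; split=> // j ltji bigj; apply: nj; exists j.
exists (fun j k => lt (f (g j)) (f (g k))); split.
- move=> j; have [k] : exists k, k = f (g j) by exists (f (g j)).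
  elim/(well_founded_ind wf): k j => k IH j kE; constructor => j' ltj'.
  by apply: (IH (f (g j'))) => //; rewrite kE.
- by move=> j k neq; apply: tot => /f_inj/g_inj.
- move=> j [h [h_inj hj]]; apply: (imin (f (g j))) => //.
  by exists (f \o g \o h); split=> //; apply: inj_comp => //; exact: inj_comp.
Qed.

(** Transfinite recursion along an order with small initial segments. The earlier values cannot
    exhaust [P i]: otherwise, sending each point of a copy of [T] inside [P i] to the stage that
    chose it would inject [T] into the segment below [i]. *)
Lemma injective_selection (T I : Type) (g : I -> T) (P : I -> set T) :
  injective g ->
  (forall i, exists f : T -> T, injective f /\ forall t, P i (f t)) ->
  exists p : I -> T, injective p /\ forall i, P i (p i).
Proof.
move=> g_inj bigP; have [lt [wf tot small]] := exists_small_segments g_inj.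
have avoid i (rec : forall j, lt j i -> T) :
    exists t, P i t /\ forall j (h : lt j i), t <> rec j h.
  apply: contrapT => none; have [f [f_inj fP]] := bigP i; apply: (small i).
  have /choice[h hP] t : exists j, exists ltji : lt j i, f t = rec j ltji.
    apply: contrapT => nt; apply: none; exists (f t); split=> // j ltji eqf.
    by apply: nt; exists j, ltji.
  exists h; split=> [s t eqh|t]; last by have [] := hP t.
  have [[ls es] [lt' et]] := (hP s, hP t); apply: f_inj; rewrite es et.
  by case: _ / eqh lt' {et} => lt'; congr rec; exact: Prop_irrelevance.
pose next i rec := sval (cid (@avoid i rec)).
pose p := Fix wf (fun=> T) next.
have pE i : p i = next i (fun j _ => p j).
  apply: Fix_eq => {}i f1 f2 eqf; congr next.
  by apply: functional_extensionality_dep => j; apply: functional_extensionality_dep.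
have pP i : P i (p i) /\ forall j, lt j i -> p i <> p j.
  by rewrite pE /next; case: cid => t [].
exists p; split=> [i j eqp|i]; last by have [] := pP i.
apply: contrapT => /tot[ltij|ltji]; first by have [_ /(_ _ ltij)] := pP j; apply.
by have [_ /(_ _ ltji)] := pP i; apply.
Qed.

(** * Continuity through finite prefixes, and a Bernstein colouring *)

Lemma eq_mkseqP (G : Type) (a b : nat -> G) n :
  mkseq a n = mkseq b n <-> forall i, i < n -> a i = b i.
Proof.
split=> [eqab i ltin|eqab].
  by rewrite -(nth_mkseq (a i) a ltin) eqab nth_mkseq.
by apply/eq_in_map => i; rewrite mem_iota => /eqab.
Qed.

Lemma eq_mkseqW (G : Type) (a b : nat -> G) m n :
  m <= n -> mkseq a n = mkseq b n -> mkseq a m = mkseq b m.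
Proof.
move=> lemn /eq_mkseqP eqab; apply/eq_mkseqP => i ltim.
exact/eqab/leq_trans/lemn.
Qed.

Lemma take_mkseq (G : Type) (a : nat -> G) m n :
  m <= n -> take m (mkseq a n) = mkseq a m.
Proof. by move=> lemn; rewrite /mkseq -map_take take_iota (minn_idPl lemn). Qed.

Definition seq_continuous (G H : Type) (f : (nat -> G) -> nat -> H) : Prop :=
  forall a n, exists m, forall b, mkseq a m = mkseq b m ->
    mkseq (f a) n = mkseq (f b) n.

(** By compactness such a map is a homeomorphism onto its image, so the images are the copies of the
    Cantor space inside itself. *)
Definition cantor_embedding (f : (nat -> bool) -> nat -> bool) : Prop :=
  injective f /\ seq_continuous f.

Lemma bernstein_coloring : exists c : (nat -> bool) -> nat,
  forall f, cantor_embedding f -> forall k, exists b, c (f b) = k.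
Proof.
(* [K r] is the projection of a closed subset of the square of the Cantor
   space; the graph of a continuous function is closed. *)
pose K (r : nat -> bool) : set (nat -> bool) :=
  [set x | exists b : nat -> bool, forall n, r (pickle (mkseq b n, mkseq x n))].
(* The implication makes [P i] everything when [K i.1] is too small, so every stage of the selection
   has room. *)
pose P (i : (nat -> bool) * nat) : set (nat -> bool) := [set x |
  (exists f : (nat -> bool) -> nat -> bool, injective f /\ forall b, K i.1 (f b)) ->
  K i.1 x].
(* Odd positions carry [r], even ones the indicator of [k]. *)
pose code (i : (nat -> bool) * nat) n := if odd n then i.1 n./2 else n./2 == i.2.
have code_inj : injective code.
  move=> [r k] [r' k'] eqc; congr pair.
    apply/funext => n; have := congr1 (@^~ n.*2.+1) eqc.
    by rewrite /code /= odd_double uphalf_double.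
  have := congr1 (@^~ k.*2) eqc; rewrite /code /= odd_double doubleK eqxx.
  by move/esym/eqP.
have bigP i : exists f : (nat -> bool) -> nat -> bool,
    injective f /\ forall b, P i (f b).
  have [[f [f_inj fK]]|small] := pselect (exists f : (nat -> bool) -> nat -> bool,
      injective f /\ forall b, K i.1 (f b)).
    by exists f; split=> // b _; exact: fK.
  by exists id; split=> // b /small.
have [p [p_inj pP]] := injective_selection code_inj bigP.
(* Injectivity of [p] makes the colour well defined; unselected points get colour 0. *)
have /choice[c cP] x : exists k, forall r k', x = p (r, k') -> k = k'.
  have [[[r k] ->]|nx] := pselect (exists i, x = p i).
    by exists k => r' k' /p_inj[].
  by exists 0 => r k xp; case: nx; exists (r, k).
exists c => f [f_inj f_cont] k.
(* [r] codes the finite approximations to the graph of [f], so [K r] is the range of [f] and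
   contains the point [p (r, k)] of colour [k]. *)
pose r n := `[< exists b m, n = pickle (mkseq b m, mkseq (f b) m) >].
have fK b : K r (f b) by exists b => n; apply/asboolP; exists b, n.
have [|b Kb] := pP (r, k); first by exists f.
exists b; apply: (cP _ r); apply/funext => i.
have [n fn] := f_cont b i.+1; pose m := maxn n i.+1.
have /asboolP[b' [m' /(pcan_inj pickleK)[eqb eqx]]] := Kb m.
have eqm : m' = m by have := congr1 size eqb; rewrite !size_mkseq.
rewrite eqm in eqb eqx.
have /fn/eq_mkseqP -> // := eq_mkseqW (leq_maxl _ _) eqb.
by have /eq_mkseqP -> // := eq_mkseqW (leq_maxr _ _) eqx.
Qed.

(** * Cantor schemes of finite sequences and their limits *)

Section CantorScheme.
Context (G : Type) (step : seq G -> bool -> seq G).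
Hypothesis step_ext : forall w b, exists x v, step w b = w ++ x :: v.

Definition scheme_node (b : nat -> bool) n := foldl step [::] (mkseq b n).

Lemma scheme_nodeS b n : scheme_node b n.+1 = step (scheme_node b n) (b n).
Proof. by rewrite /scheme_node mkseqS foldl_rcons. Qed.

Lemma size_scheme_node b n : n <= size (scheme_node b n).
Proof.
elim: n => // n IH; rewrite scheme_nodeS.
have [x [v ->]] := step_ext (scheme_node b n) (b n).
by rewrite size_cat /= addnS ltnS (leq_trans IH) ?leq_addr.
Qed.

Lemma scheme_node_prefix b m n : m <= n ->
  exists v, scheme_node b n = scheme_node b m ++ v.
Proof.
elim: n => [|n IH]; first by rewrite leqn0 => /eqP->; exists [::]; rewrite cats0.
rewrite leq_eqVlt => /predU1P[->|/IH[v nodeE]]; first by exists [::]; rewrite cats0.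
have [x [w stepE]] := step_ext (scheme_node b n) (b n).
by exists (v ++ x :: w); rewrite scheme_nodeS stepE nodeE catA.
Qed.

Lemma scheme_limit : exists F : (nat -> bool) -> nat -> G,
  forall b n, mkseq (F b) (size (scheme_node b n)) = scheme_node b n.
Proof.
have [x0 _] := step_ext [::] true.
(* Node [i.+1] is longer than [i], so the default [x0] is never read. *)
exists (fun b i => nth x0 (scheme_node b i.+1) i) => b n.
apply: (@eq_from_nth _ x0); rewrite size_mkseq // => i lti.
rewrite nth_mkseq //; case: (leqP i.+1 n) => [|/ltnW] le.
  have [v ->] := scheme_node_prefix b le; rewrite nth_cat.
  by have -> : i < size (scheme_node b i.+1) by exact: size_scheme_node.
by have [v ->] := scheme_node_prefix b le; rewrite nth_cat lti.
Qed.

(** At the first index where [b] and [b'] differ, their runs leave a common node through different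
    children, and [L] tells these apart. For continuity, [m] bits of [b] fix at least [m] entries of
    [F b]. *)
Lemma scheme_embedding (L : (nat -> G) -> nat -> bool)
    (F : (nat -> bool) -> nat -> G) :
  (forall b n, mkseq (F b) (size (scheme_node b n)) = scheme_node b n) ->
  seq_continuous L ->
  (forall w a a', mkseq a (size (step w false)) = step w false ->
    mkseq a' (size (step w true)) = step w true -> L a <> L a') ->
  cantor_embedding (L \o F).
Proof.
move=> FE L_cont L_split; split=> [b b' /= eqL|b n /=]; last first.
  have [m Lm] := L_cont (F b) n; exists m => b' eqb; apply: Lm.
  apply: (eq_mkseqW (size_scheme_node b m)).
  have eqn : scheme_node b m = scheme_node b' m by rewrite /scheme_node eqb.
  by rewrite FE eqn FE.
apply/funext => n; elim/ltn_ind: n => n IH; apply: contrapT => neq.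
have eqn : scheme_node b n = scheme_node b' n.
  by rewrite /scheme_node; congr foldl; exact/eq_mkseqP.
have := (FE b n.+1, FE b' n.+1); rewrite !scheme_nodeS -eqn.
case: (b n) (b' n) neq => [] [] // _ [Fb Fb'].
  by case: (L_split _ _ _ Fb' Fb).
by case: (L_split _ _ _ Fb Fb').
Qed.

End CantorScheme.

(** * Branches of the binary tree as an almost disjoint family *)

Definition branch (x : nat -> bool) : set (seq bool) := range (mkseq x).

Lemma branchE x s : branch x s <-> s = mkseq x (size s).
Proof.
split=> [[n _ <-]|->]; first by rewrite size_mkseq.
by exists (size s).
Qed.

Lemma branch_inj : injective branch.
Proof.
move=> x y eqb; apply/funext => i.
have : branch y (mkseq x i.+1) by rewrite -eqb; exists i.+1.
by move/branchE; rewrite size_mkseq => /eq_mkseqP; apply.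
Qed.

Lemma branch_infinite x : infinite_set (branch x).
Proof.
have mkseq_inj : injective (mkseq x).
  by move=> m n /(congr1 size); rewrite !size_mkseq.
by rewrite /branch (eq_finite_set (inj_card_eq (in2W mkseq_inj))); exact: infinite_nat.
Qed.

Definition branches (X : set (nat -> bool)) : set (set (seq bool)) := branch @` X.

Lemma mkseq_neq (G : Type) (x y : nat -> G) : x <> y ->
  exists m, forall n, m <= n -> mkseq x n <> mkseq y n.
Proof.
move=> neq; have [m xym] : exists m, x m <> y m.
  by apply/existsNP => eqxy; apply: neq; exact/funext.
by exists m.+1 => n ltmn /eq_mkseqP/(_ m ltmn).
Qed.

Lemma branches_almost_disjoint X : almost_disjoint (branches X).
Proof.
move=> _ _ [x Xx <-] [y Xy <-] neq.
have [|m xy] := @mkseq_neq _ x y; first by move=> eqxy; apply: neq; rewrite eqxy.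
apply: (sub_finite_set _ (finite_image (mkseq x) (finite_II m))) => s [[n _ <-]].
move=> /branchE; rewrite size_mkseq => eqn; exists n => //=.
by rewrite ltnNge; apply/negP => /xy.
Qed.

(** * A compatible uniformity on the space of nodes and leaves *)

Section PsiBranches.
Context (X : set (nat -> bool)).
Local Notation A := (branches X).
Implicit Types (u v z : Psi A) (a : A) (x : nat -> bool) (n : nat).

Lemma ex_stem a : exists x, X x /\ branch x = \val a.
Proof. by case: (set_valP a) => x Xx eqx; exists x. Qed.

Definition stem a : nat -> bool := sval (cid (ex_stem a)).

Lemma stem_in a : X (stem a).
Proof. by rewrite /stem; case: cid => x []. Qed.

Lemma branch_stem a : branch (stem a) = \val a.
Proof. by rewrite /stem; case: cid => x []. Qed.

Lemma stem_inj : injective stem.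
Proof. by move=> a b eqs; apply: val_inj; rewrite -!branch_stem eqs. Qed.

Lemma ex_leaf x : X x -> exists a, stem a = x.
Proof.
move=> Xx; have Ax : branch x \in A by apply/mem_set; exists x.
by exists (SigSub Ax); apply: branch_inj; rewrite branch_stem.
Qed.

Lemma nbhs_node (s : seq bool) (N : set (Psi A)) :
  nbhs (inl s : Psi A) N <-> N (inl s).
Proof. by split=> [/principal_filterP|Ns]; [|exact/principal_filterP]. Qed.

Lemma nbhs_leaf a (N : set (Psi A)) : nbhs (inr a : Psi A) N <->
  N (inr a) /\ exists m, forall n, m <= n -> N (inl (mkseq (stem a) n)).
Proof.
split=> [[F finF FN]|[Na [m mN]]].
  split; first by apply: FN; left.
  have /finite_seqP[l lF] := finF; exists (\max_(s <- l) size s).+1 => n ltn.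
  apply: FN; right; exists (mkseq (stem a) n) => //; rewrite -branch_stem.
  split; first by exists n.
  rewrite lF => /= sl; move: ltn.
  rewrite ltnNge -[X in (X <= _)%N](size_mkseq (stem a)).
  by rewrite (leq_bigmax_seq (F := size)).
exists (mkseq (stem a) @` `I_m); first by apply/finite_image/finite_II.
move=> _ [->//|[s [/= sa nFs] <-]].
move: sa nFs; rewrite -branch_stem => -[n _ <-] nFn; apply: mN.
by rewrite leqNgt; apply/negP => ltnm; apply: nFn; exists n.
Qed.

Definition trunc n u : seq bool :=
  match u with inl s => take n s | inr a => mkseq (stem a) n end.

Definition on_branch u x : bool :=
  match u with inl s => s == mkseq x (size s) | inr a => `[< stem a = x >] end.

(** An equivalence relation, hence its own inverse and its own square; the list [l] holds the
    branches that are split off. *)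
Definition basic_ent n (l : seq (nat -> bool)) : set (Psi A * Psi A) :=
  [set uv | trunc n uv.1 = trunc n uv.2 /\
            map (on_branch uv.1) l = map (on_branch uv.2) l].

Definition psi_ent : set_system (Psi A * Psi A) :=
  [set V | exists n l, basic_ent n l `<=` V].

Lemma trunc_leq m n u v : m <= n -> trunc n u = trunc n v -> trunc m u = trunc m v.
Proof.
have E w : m <= n -> trunc m w = take m (trunc n w).
  move=> lemn; case: w => [s|a] /=; first by rewrite take_takel.
  by rewrite take_mkseq.
by move=> lemn eqn; rewrite !E // eqn.
Qed.

Lemma trunc_node n (s : seq bool) u : size s < n -> trunc n u = s -> u = inl s.
Proof.
case: u => [t|a] /= ltn.
  case: (leqP (size t) n) => [le|/ltnW le]; first by rewrite take_oversize // => ->.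
  by move=> eqs; move: ltn; rewrite -eqs size_takel // ltnn.
by move=> eqs; move: ltn; rewrite -eqs size_mkseq ltnn.
Qed.

Lemma psi_ent_filter : Filter psi_ent.
Proof.
split; first by exists 0, [::].
  move=> V W [n [l nlV]] [n' [l' nlW]]; exists (maxn n n'), (l ++ l').
  move=> uv [eqt]; rewrite !map_cat => /eqP.
  rewrite eqseq_cat ?size_map // => /andP[/eqP eql /eqP eql']; split.
    by apply: nlV; split=> //; apply: trunc_leq eqt; exact: leq_maxl.
  by apply: nlW; split=> //; apply: trunc_leq eqt; exact: leq_maxr.
by move=> V W VW [n [l nlV]]; exists n, l; exact: subset_trans VW.
Qed.

Lemma psi_ent_diagonal V : psi_ent V -> diagonal `<=` V.
Proof. by move=> [n [l nlV]] [u v] uv; have {uv}-> : u = v by []; exact: nlV. Qed.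

Lemma psi_ent_inv V : psi_ent V -> psi_ent (V^-1)%relation.
Proof. by move=> [n [l nlV]]; exists n, l => -[u v] [e1 e2]; apply: nlV. Qed.

Lemma psi_ent_split V : psi_ent V -> exists2 W, psi_ent W & (W \; W `<=` V)%relation.
Proof.
move=> [n [l nlV]]; exists (basic_ent n l); first by exists n, l.
by move=> [u w] [v [e1 e2] [e3 e4]]; apply: nlV; split; rewrite /= ?e1 ?e2.
Qed.

Lemma on_branch_eventually a (l : seq (nat -> bool)) : exists m, forall n, m <= n ->
  map (on_branch (inr a)) l = map (on_branch (inl (mkseq (stem a) n))) l.
Proof.
elim: l => [|x l [m IH]]; first by exists 0.
have [eqx|/mkseq_neq[k xk]] := pselect (stem a = x).
  exists m => n lemn /=; rewrite (IH n) //; congr cons.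
  by rewrite size_mkseq eqx eqxx; apply/asboolP.
exists (maxn m k) => n; rewrite geq_max => /andP[lemn lekn] /=; rewrite (IH n) //.
congr cons; rewrite size_mkseq (introF eqP (xk _ lekn)); apply/asboolPn => eqx.
by apply: (xk n) => //; rewrite eqx.
Qed.

(** Truncating one past its length isolates a node. For a leaf, splitting off its own branch leaves,
    besides the leaf, only nodes of that branch of length at least [m]. *)
Lemma psi_nbhsE : @nbhs (Psi A) (Psi A) = nbhs_ psi_ent.
Proof.
apply/funext => u; rewrite nbhs_E; apply/seteqP; split=> N.
  case: u => [s|a].
    move=> /nbhs_node Ns; exists (basic_ent (size s).+1 [::]).
      by exists (size s).+1, [::].
    move=> v /xsectionP[/esym/= eqt _].
    by move: eqt; rewrite take_oversize // => /trunc_node ->.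
  move=> /nbhs_leaf[Na [m mN]]; exists (basic_ent m [:: stem a]).
    by exists m, [:: stem a].
  move=> v /xsectionP[/= eqt [onv]].
  have {onv} : on_branch v (stem a) by rewrite -onv; apply/asboolP.
  case: v eqt => [s|b] /= eqt; last by move=> /asboolP/stem_inj ->.
  move=> /eqP sE; rewrite sE; apply: mN.
  by have := congr1 size eqt; rewrite size_mkseq size_take; case: ltnP => [/ltnW //|_ ->].
move=> [V [n [l nlV]] VN]; apply: filterS VN _.
case: u => [s|a]; first by apply/nbhs_node/mem_set/nlV.
apply/nbhs_leaf; split; first exact/mem_set/nlV.
have [m am] := on_branch_eventually a l; exists (maxn m n) => k.
rewrite geq_max => /andP[lemk lenk]; apply/mem_set/nlV; split; last exact: am.
by rewrite /= take_mkseq.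
Qed.

End PsiBranches.

(** * Semi-proximality *)

Lemma mkseq_extend (G : Type) (w : seq G) (x : nat -> G) n :
  mkseq x (size w) = w -> size w < n -> exists g v, mkseq x n = w ++ g :: v.
Proof.
move=> xw ltn; rewrite -(cat_take_drop (size w) (mkseq x n)) take_mkseq ?(ltnW ltn) // xw.
case: drop (size_drop (size w) (mkseq x n)) => [|g v _]; last by exists g, v.
by rewrite size_mkseq => /esym/eqP; rewrite subn_eq0 leqNgt ltn.
Qed.

Lemma branches_semi_proximal (X : set (nat -> bool)) :
  (forall f, cantor_embedding f -> exists b, ~ X (f b)) ->
  semi_proximal (Psi (branches X)).
Proof.
move=> noX; pose P := Psi (branches X).
pose U : uniformType := HB.pack_for uniformType P (Nbhs_isUniform_mixin.Build P
  (@psi_ent_filter X) (@psi_ent_diagonal X) (@psi_ent_inv X) (@psi_ent_split X)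
  (@psi_nbhsE X)).
exists U; split=> // -[sigma win].
(* A sequence [a] of points codes a run of Player I: inning [n] splits off the branches of [a 0],
   ..., [a n]. *)
pose W (a : nat -> nat -> bool) n : set (P * P) := basic_ent n (mkseq a n.+1).
pose moves a : nat -> P := playerII_moves sigma (W a).
have legal a : playerI_legal (@entourage U) (W a).
  split=> n; first by exists n, (mkseq a n.+1).
  move=> uv [eqt eqb]; split; first exact: trunc_leq eqt.
  by move: eqb; rewrite (mkseqS a n.+1) !map_rcons => /rcons_inj/(congr1 fst).
(* As Player I loses, some [z] lies in every section. Were [z] a node, or the leaf of some [a i],
   the moves would converge to [z]; so [z] is another leaf and [y] is its stem. *)
have target a : exists y, [/\ X y, forall i, a i <> y &
    forall n, trunc n (moves a n) = mkseq y n].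
  have [_ nwin] := win _ (legal a).
  have [z zP] : exists z, forall n, W a n (moves a n, z).
    apply: contrapT => none; apply: nwin; left; rewrite -subset0 => z zP.
    by apply: none; exists z => n; exact/xsectionP/(zP n I).
  case: z zP => [s|l] zP.
    exfalso; apply: nwin; right; exists (inl s) => N /nbhs_node Ns.
    exists (size s).+1 => // n /= ltn; have [/= eqt _] := zP n.
    rewrite take_oversize in eqt; last exact: ltnW.
    by rewrite -/(moves a n) (trunc_node ltn eqt).
  exists (stem l); split; first exact: stem_in.
    move=> i ai; apply: nwin; right; exists (inr l) => N /nbhs_leaf[Nl [m mN]].
    exists (maxn m i) => // n /=; rewrite geq_max => /andP[lemn lein].
    have [eqt /eq_in_map eqb] := zP n.
    have : on_branch (moves a n) (stem l).
      rewrite -ai eqb; first by rewrite /= ai; apply/asboolP.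
      by apply: map_f; rewrite mem_iota.
    rewrite -/(moves a n); case: (moves a n) eqt => [s|b] /= eqt.
      move=> /eqP ->; apply: mN; apply: (leq_trans lemn).
      by have := congr1 size eqt; rewrite size_mkseq size_take;
      case: ltnP => [/ltnW //|_ ->].
    by move=> /asboolP/stem_inj ->.
  by move=> n; have [] := zP n.
have /choice[L LP] := target.
have L_cont : seq_continuous L.
  (* The move of inning [n] depends on the entourages 0 to [n], hence on [n.+1] entries of [a]. *)
  move=> a n; exists n.+1 => b eqab.
  have [_ _ <-] := LP a; have [_ _ <-] := LP b; rewrite /moves /playerII_moves.
  congr (trunc _ (sigma _)); apply/eq_mkseqP => i; rewrite ltnS => lein.
  by rewrite /W (eq_mkseqW _ eqab).
(* Player I may either ignore the limit point of a play or, at any later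
   stage, isolate its branch; since Player II wins, the limit changes. *)
have split_play w : exists p : seq (nat -> bool) * seq (nat -> bool),
    [/\ exists g v, p.1 = w ++ g :: v, exists g v, p.2 = w ++ g :: v &
    forall a a', mkseq a (size p.1) = p.1 -> mkseq a' (size p.2) = p.2 ->
      L a <> L a'].
  (* The default value of [nth] continues [w] by the constant [y], so [a1] splits off the limit of
     [a0] right after [w]. *)
  pose ext y i := nth y w i.
  have extw y : mkseq (ext y) (size w) = w by exact: mkseq_nth.
  pose a0 := ext (fun=> true); pose a1 := ext (L a0).
  have neq : L a1 <> L a0.
    have [_ /(_ (size w)) ] := LP a1; rewrite /a1 /ext nth_default // => neq _ eqL.
    exact: neq.
  have [m /(_ m (leqnn m)) neqm] := mkseq_neq neq.
  have [k0 k0P] := L_cont a0 m; have [k1 k1P] := L_cont a1 m.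
  (* Long enough to freeze both limits up to [m], where they differ; [(size w).+1] makes the
     extensions proper. *)
  exists (mkseq a0 (maxn k0 (size w).+1), mkseq a1 (maxn k1 (size w).+1)); split=> /=.
  - by apply: mkseq_extend; [exact: extw | rewrite leq_max leqnn orbT].
  - by apply: mkseq_extend; [exact: extw | rewrite leq_max leqnn orbT].
  - move=> a a'; rewrite !size_mkseq => aE a'E eqL; apply: neqm.
    rewrite (k1P a') ?(k0P a) ?eqL //.
      by apply/esym/(eq_mkseqW (leq_maxl k0 (size w).+1)).
    by apply/esym/(eq_mkseqW (leq_maxl k1 (size w).+1)).
have /choice[p pP] := split_play.
pose step w (b : bool) := if b then (p w).2 else (p w).1.
have step_ext w b : exists g v, step w b = w ++ g :: v.
  by have [] := pP w; case: b.
have [F FE] := scheme_limit step_ext.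
have [|b] := noX (L \o F); last by have [] := LP (F b).
apply: (scheme_embedding step_ext FE L_cont) => w a a'.
by have [_ _] := pP w; apply.
Qed.

(** * Non-normality *)

Lemma leaves_closed (X : set (nat -> bool)) (Y : set (branches X)) :
  closed ([set inr a | a in Y] : set (Psi (branches X))).
Proof.
move=> [s|a] cl.
  have [|_ [[b _ <-] //]] := cl [set inl s]; exact/nbhs_node.
have [|_ [[b Yb <-] []]] := cl (inr a |` range inl).
- apply/nbhs_leaf; split; first by left.
  by exists 0 => n _; right; exists (mkseq (stem a) n).
- by move=> [<-]; exists b.
- by case.
Qed.

(** The default value of [nth] appends [b] to [w]; thus every cone of the tree contains points of
    each colour. *)
Lemma cone_embedding (w : seq bool) :
  cantor_embedding (fun b i => nth (b (i - size w)) w i).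
Proof.
split=> [b b' eqf|b n].
  apply/funext => i; have := congr1 (@^~ (size w + i)) eqf.
  by rewrite !nth_default ?leq_addr // addKn.
exists n => b' /eq_mkseqP eqb; apply/eq_mkseqP => i ltin.
by rewrite (eqb (i - size w)) // (leq_ltn_trans (leq_subr _ _)).
Qed.

Lemma branches_not_normal (X Y : set (nat -> bool)) :
  (forall f, cantor_embedding f -> exists b, (X `&` Y) (f b)) ->
  (forall f, cantor_embedding f -> exists b, (X `\` Y) (f b)) ->
  ~ normal_space (Psi (branches X)).
Proof.
move=> hitY hitZ normal.
pose C (Z : set (nat -> bool)) : set (Psi (branches X)) :=
  [set inr a | a in [set a | Z (stem a)]].
have [|B nbhsB clB] := normal (C Y) (@leaves_closed _ _) (~` C (~` Y)).
  move=> _ [a Ya <-]; apply: open_nbhs_nbhs; split.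
    exact/closed_openC/(@leaves_closed X).
  by move=> [b nYb [eqab]]; apply: nYb; rewrite /= eqab.
have BY x : X x -> Y x -> exists m, forall n, m <= n -> B (inl (mkseq x n)).
  move=> /ex_leaf[a ax] Yx; have /nbhs_leaf[_] : nbhs (inr a : Psi (branches X)) B.
    by apply: nbhsB; exists a => //=; rewrite ax.
  by rewrite ax.
have BZ x : X x -> ~ Y x -> exists m, forall n, m <= n -> ~ B (inl (mkseq x n)).
  move=> /ex_leaf[a ax] nYx; have : ~ closure B (inr a : Psi (branches X)).
    by move=> /clB; apply; exists a => //=; rewrite ax.
  move=> /existsNP[N /not_implyP[/nbhs_leaf[_ [m mN]] NB]].
  exists m => n lemn Bn; apply: NB; exists (inl (mkseq x n)); split=> //.
  by rewrite -ax; exact: mN.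
(* The cone of [w] contains a point of [X] outside [Y], whose nodes eventually leave [B]. *)
have /choice[down downP] (w : seq bool) : exists t, ~ B (inl t) /\
    exists g v, t = w ++ g :: v.
  have [b [Xx nYx]] := hitZ _ (cone_embedding w).
  have [m mB] := BZ _ Xx nYx; set x := (x in X x) in Xx nYx mB.
  exists (mkseq x (maxn m (size w).+1)); split; first by apply: mB; exact: leq_maxl.
  apply: mkseq_extend; last by rewrite leq_max leqnn orbT.
  apply: (@eq_from_nth _ true); rewrite size_mkseq // => i lti.
  by rewrite nth_mkseq //; exact: set_nth_default.
(* Appending [b] first makes the two children incompatible. *)
pose step w b := down (rcons w b).
have stepE w b : exists v, step w b = w ++ b :: v.
  have [_ [g [v eqd]]] := downP (rcons w b).
  by exists (g :: v); rewrite /step eqd cat_rcons.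
have step_ext w b : exists g v, step w b = w ++ g :: v.
  by have [v] := stepE w b; exists b, v.
have [F FE] := scheme_limit step_ext.
have [|b [Xx Yx]] := hitY (id \o F).
  apply: (scheme_embedding step_ext FE); first by move=> a n; exists n.
  have at_size a w c : mkseq a (size (step w c)) = step w c -> a (size w) = c.
    have [v ->] := stepE w c.
    move=> /(congr1 (nth c ^~ (size w))).
    by rewrite nth_cat ltnn subnn nth_mkseq // size_cat /= addnS ltnS leq_addr.
  by move=> w a a' /at_size a0 /at_size a1 eqa; move: a0; rewrite eqa a1.
(* The nodes of a point of [Y] are eventually in [B], but node [m.+1] of the scheme is a longer
   prefix chosen outside [B]. *)
have [m mB] := BY _ Xx Yx.
apply: (downP (rcons (scheme_node step b m) (b m))).1.
rewrite -/(step _ _) -scheme_nodeS -FE; apply: mB.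
by apply: leq_trans (size_scheme_node step_ext _ _).
Qed.

Theorem mainTheorem2 :
  exists (D : Type) (A : set (set D)),
    [/\ countable [set: D] /\ infinite_set [set: D],
        forall a, A a -> infinite_set a,
        almost_disjoint A,
        semi_proximal (Psi A) &
        ~ normal_space (Psi A)].
Proof.
have [c hit] := bernstein_coloring.
(* Colour 2 keeps perfect sets out of the set of stems; colours 0 and 1 are the two that cannot be
   separated. *)
exists (seq bool), (branches [set x | c x <> 2]); split.
- split; first exact: countableP.
  by apply: (sub_infinite_set _ (@branch_infinite (fun=> true))).
- by move=> _ [x _ <-]; exact: branch_infinite.
- exact: branches_almost_disjoint.
- by apply: branches_semi_proximal => f /hit/(_ 2)[b cb]; exists b; exact.
- apply: (@branches_not_normal _ [set x | c x = 0]) => f /hit hitf.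
    by have [b cb] := hitf 0; exists b; split=> //=; rewrite cb.
  by have [b cb] := hitf 1; exists b; split=> /=; rewrite cb.
Qed.
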